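(* Let $\mu$ be a typical weight, i.e. $\lim_{|v|\to\infty}\mu(v) = 0$. Let $\psi: T \to \mathbb{C}$ be a function and $\varphi: T \to T$ a self-map with infinite range (i.e. $\varphi(T)$ is infinite) for which $W_{\psi,\varphi}$ is bounded on $L_\mu^0$. Then, as an operator on $L_\mu^0$, $$\|W_{\psi,\varphi}\|_e = \limsup_{|v| \to \infty} \frac{\mu(v)}{\mu(\varphi(v))}|\psi(v)|.$$ Moreover, $W_{\psi,\varphi}$ is compact on $L_\mu^0$ if and only if $$\lim_{|v| \to \infty} \frac{\mu(v)}{\mu(\varphi(v))}|\psi(v)| = 0.$$
   Context: $(T,\mathrm{d})$ is a metric space with a distinguished point $o$ (the root); the length of $v \in T$ is $|v| = \mathrm{d}(o,v)$. $T$ is assumed locally finite (for every $M>0$ the set $\{v \in T : |v| < M\}$ is finite) and unbounded (for every $M>0$ there is $v \in T$ with $|v| \ge M$). $\mu: T \to (0,\infty)$ is a positive function (a weight). $L_\mu^\infty$ is the Banach space of functions $f: T \to \mathbb{C}$ with $\|f\|_\mu = \sup_{v \in T} \mu(v)|f(v)| < \infty$, and $L_\mu^0$ is its closed subspace of those $f$ with $\lim_{|v|\to\infty} \mu(v)|f(v)| = 0$. The weighted composition operator is the linear map $W_{\psi,\varphi} f = \psi\,(f\circ\varphi)$; it is bounded (compact) on $L_\mu^0$ if it is a bounded (compact) operator from $L_\mu^0$ to itself. The essential norm of a bounded operator $A$ on a Banach space $X$ is $\|A\|_e = \inf\{\|A-K\| : K \text{ a compact operator on } X\}$. *)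

(* Defs.v *)
From HB Require Import structures.
From mathcomp Require Export all_boot all_order all_algebra.
From mathcomp Require Export all_classical all_reals all_analysis.
From mathcomp Require Export complex.

Set Implicit Arguments.
Unset Strict Implicit.
Unset Printing Implicit Defensive.

Import Order.TTheory GRing.Theory Num.Theory.
Import numFieldNormedType.Exports.
Local Open Scope classical_set_scope.
Local Open Scope complex_scope.
Local Open Scope ring_scope.

(* The norm of a normedModType over R[i] takes (real) values in R[i]; the real
   number is recovered by Re. Likewise [Normc.normc z] is the modulus of z as
   an element of R, and [`|z|] is the same number in R[i]. *)
Section operators.
Context {R : realType} {X : normedModType R[i]}.

Definition unit_cball : set X := [set x | `|x| <= 1].

Definition bounded_op (A : {linear X -> X}) : Prop :=
  exists M : R, forall x : X, `|A x| <= M%:C * `|x|.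

Definition compact_op (A : {linear X -> X}) : Prop :=
  precompact (A @` unit_cball).

(* Defined for arbitrary maps, with value +oo on unbounded ones. *)
Definition opnorm (A : X -> X) : \bar R :=
  ereal_sup [set (complex.Re `|A x|)%:E | x in unit_cball].

Definition essnorm (A : {linear X -> X}) : \bar R :=
  ereal_inf [set opnorm (A \- K) | K in
    [set K : {linear X -> X} | compact_op K]].

End operators.

Section rooted_metric_space.
Context {R : realType} {T : metricType R}.
Implicit Types o v : T.

Definition vlength o v : R := mdist o v.

Definition locally_finite o : Prop :=
  forall M : R, 0 < M -> finite_set [set v | vlength o v < M].

Definition unbounded_from o : Prop :=
  forall M : R, 0 < M -> exists v, M <= vlength o v.

(* The filter of "|v| -> oo". *)
Definition at_infty o : set_system T :=
  filter_from [set: R] (fun M => [set v | M <= vlength o v]).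

Global Instance at_infty_filter o : Filter (at_infty o).
Proof.
apply: filter_from_filter; first by exists 0.
move=> M N _ _; exists (Num.max M N) => // v /=.
by rewrite ge_max => /andP[].
Qed.

Definition typical_weight o (mu : T -> {posnum R}) : Prop :=
  (mu v)%:num @[v --> at_infty o] --> (0 : R).

End rooted_metric_space.

Section weighted_spaces.
Context {R : realType} {T : metricType R}.
Variables (o : T) (mu : T -> {posnum R}).
Implicit Types f g : T -> R[i].

Definition wmod f (v : T) : R := (mu v)%:num * Normc.normc (f v).

Definition wnorm f : R := sup (range (wmod f)).

Definition Linfty f : Prop := has_ubound (range (wmod f)).

Definition Lzero : {pred T -> R[i]} :=
  [pred f | `[< Linfty f /\ wmod f v @[v --> at_infty o] --> (0 : R) >]].

Lemma LzeroP f : reflect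
  (Linfty f /\ wmod f v @[v --> at_infty o] --> (0 : R)) (f \in Lzero).
Proof. exact: asboolP. Qed.

Lemma wmod_ge0 f v : 0 <= wmod f v.
Proof.
apply: mulr_ge0 => //.
by case: (f v) => a b /=; exact: sqrtr_ge0.
Qed.

Lemma wmodD f g v : wmod (f + g) v <= wmod f v + wmod g v.
Proof. by rewrite /wmod -mulrDr ler_pM2l//; exact: le_normcD. Qed.

Lemma wmodZ (a : R[i]) f v : wmod (a *: f) v = Normc.normc a * wmod f v.
Proof. by rewrite /wmod Normc.normcM mulrCA. Qed.

Lemma wmod0 v : wmod 0 v = 0.
Proof. by rewrite /wmod Normc.normc0 mulr0. Qed.

Lemma wmod_le_wnorm f v : Linfty f -> wmod f v <= wnorm f.
Proof. by move=> fb; apply: ub_le_sup => //; exists v. Qed.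

Lemma wnorm_le f (M : R) : (forall v, wmod f v <= M) -> wnorm f <= M.
Proof.
move=> h; apply: ge_sup; first by exists (wmod f o); exists o.
by move=> _ [v _ <-].
Qed.

Lemma Lzero_submod_closed : submod_closed Lzero.
Proof.
split.
  apply/LzeroP; split; first by exists 0 => _ [v _ <-]; rewrite wmod0.
  rewrite (_ : wmod 0 = cst 0); first exact: cvg_cst.
  by apply/funext => v; rewrite wmod0.
move=> a f g /LzeroP[[M Mf] f0] /LzeroP[[N Ng] g0]; apply/LzeroP.
have le v : wmod (a *: f + g) v <= Normc.normc a * wmod f v + wmod g v.
  by rewrite -wmodZ; exact: wmodD.
have a0 : 0 <= Normc.normc a by case: a {le} => x y /=; exact: sqrtr_ge0.
split.
  exists (Normc.normc a * M + N) => _ [v _ <-]; apply: le_trans (le v) _.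
  by rewrite lerD ?ler_wpM2l//; [apply: Mf|apply: Ng]; exists v.
apply: (@squeeze_cvgr _ _ _ _ (cst 0)
  (fun v => Normc.normc a * wmod f v + wmod g v)).
- by apply: nearW => v; rewrite wmod_ge0 le.
- exact: cvg_cst.
- rewrite -[X in _ --> X](_ : Normc.normc a * 0 + 0 = 0); last first.
    by rewrite mulr0 addr0.
  by apply: cvgD g0; apply: cvgMr.
Qed.

HB.instance Definition _ :=
  GRing.isSubmodClosed.Build _ _ Lzero Lzero_submod_closed.

Record LzeroType := MkLzero {
  Lzero_fun :> T -> R[i] ;
  _ : Lzero_fun \in Lzero }.

HB.instance Definition _ := [isSub for Lzero_fun].
HB.instance Definition _ := [Choice of LzeroType by <:].
HB.instance Definition _ := [SubChoice_isSubLmodule of LzeroType by <:].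

Let nm (f : LzeroType) : R[i] := (wnorm f)%:C.

Let LzeroB (f : LzeroType) : Linfty f.
Proof. by have /LzeroP[] := valP f. Qed.

Let nmD (f g : LzeroType) : nm (f + g) <= nm f + nm g.
Proof.
rewrite /nm -rmorphD lecR; apply: wnorm_le => v.
by apply: le_trans (wmodD _ _ v) _; apply: lerD; apply: wmod_le_wnorm.
Qed.

Let nmZ (a : R[i]) (f : LzeroType) : nm (a *: f) = `|a| * nm f.
Proof.
rewrite /nm -[`|a|]/((Normc.normc a)%:C) -rmorphM; congr (_%:C).
have a0 : 0 <= Normc.normc a by case: a => x y /=; exact: sqrtr_ge0.
have le (b : R[i]) (g : LzeroType) : wnorm (b *: g) <= Normc.normc b * wnorm g.
  apply: wnorm_le => v; rewrite wmodZ ler_wpM2l ?wmod_le_wnorm//.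
  by case: b => x y /=; exact: sqrtr_ge0.
apply/eqP; rewrite eq_le le /=.
have [->|an0] := eqVneq a 0.
  rewrite Normc.normc0 mul0r; apply: le_trans (wmod_ge0 _ o) _.
  exact: (@wmod_le_wnorm (0 *: f : LzeroType) o).
have na : 0 < Normc.normc a.
  by rewrite lt_neqAle a0 andbT eq_sym; apply: contra an0 => /eqP/Normc.eq0_normc ->.
rewrite -ler_pdivlMl// -Normc.normcV.
rewrite -[X in wnorm (Lzero_fun X) <= _](scalerK an0 f).
exact: le.
Qed.

Let nm0_eq0 (f : LzeroType) : nm f = 0 -> f = 0.
Proof.
move=> /(congr1 (@complex.Re R)) /= f0; apply: val_inj; apply/funext => v /=.
apply: Normc.eq0_normc; apply/eqP; rewrite eq_le.
have := wmod_le_wnorm v (LzeroB f); rewrite f0 /wmod pmulr_rle0// => -> /=.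
by case: (Lzero_fun f v) => a b /=; exact: sqrtr_ge0.
Qed.

HB.instance Definition _ :=
  @Lmodule_isNormed.Build R[i] LzeroType nm nmD nmZ nm0_eq0.

End weighted_spaces.

Lemma Lzero_normE {R : realType} {T : metricType R} (o : T)
  (mu : T -> {posnum R}) (f : LzeroType o mu) : `|f| = (wnorm mu f)%:C.
Proof. by []. Qed.

Definition wcomp {R : realType} {T : metricType R} (psi : T -> R[i])
  (phi : T -> T) (f : T -> R[i]) : T -> R[i] := fun v => psi v * f (phi v).

(* Main.v *)
(** The identity [wmod (W f) v = w v * wmod f (phi v)] drives everything. By
local finiteness the filter [|v| -> oo] is the cofinite one, so if [V] is a
neighbourhood of infinity then the image [phi (~V)] is finite; composing [W]
with the truncation to this image gives a compact operator at distance at most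
[sup_V w] from [W]. Conversely a compact [K] maps all but finitely many of the
normalized point masses [peak [:: u]] to vectors of norm [< e], whereas
[W (peak [:: phi v])] has norm at least [w v]; since [W (peak [:: u])] vanishes
at infinity, [w] tends to [0] on each fibre of [phi], so [w v <= ||W - K|| + e]
for all but finitely many [v]. *)

From HB Require Import structures.
Require Import Defs.
From mathcomp Require Import ring lra.
Set Implicit Arguments.
Unset Strict Implicit.
Unset Printing Implicit Defensive.
Import Order.TTheory GRing.Theory Num.Theory.
Import numFieldNormedType.Exports.
Local Open Scope classical_set_scope.
Local Open Scope ring_scope.

(** Compactness yields a cluster point of the image filter, and an ultrafilter converges to each of
    its cluster points. *)
Lemma ultra_cvg_compact (I : choiceType) (X : topologicalType)
    (F : set_system I) (h : I -> X) (A : set X) :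
  UltraFilter F -> compact A -> F (h @^-1` A) -> exists x : X, h @ F --> x.
Proof.
move=> UF cA FA; have [x [_ clx]] := cA (h @ F) _ FA.
exists x => N Nx; have [//|FN] := in_ultra_setVsetC (h @^-1` N) UF.
by have [y [nNy /nNy]] := clx (~` N) N FN Nx.
Qed.

(** * Modulus, real part and imaginary part *)

Section modulus.
Context {R : realType}.
Implicit Types z : R[i].

Lemma normc_ge0 z : 0 <= Normc.normc z.
Proof. by case: z => a b; exact: sqrtr_ge0. Qed.

Lemma normc_real (r : R) : 0 <= r -> Normc.normc r%:C%C = r.
Proof.
by move=> r0; rewrite /Normc.normc /= expr0n addr0 sqrtr_sqr ger0_norm.
Qed.

Lemma Re_le_normc z : `|complex.Re z| <= Normc.normc z.
Proof.
by case: z => a b /=; rewrite -sqrtr_sqr ler_sqrt ?lerDl ?addr_ge0 ?sqr_ge0.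
Qed.

Lemma Im_le_normc z : `|complex.Im z| <= Normc.normc z.
Proof.
by case: z => a b /=; rewrite -sqrtr_sqr ler_sqrt ?lerDr ?addr_ge0 ?sqr_ge0.
Qed.

Lemma normc_le_Re_Im z :
  Normc.normc z <= `|complex.Re z| + `|complex.Im z|.
Proof.
case: z => a b /=; rewrite -[leRHS]ger0_norm ?addr_ge0// -sqrtr_sqr.
rewrite ler_sqrt ?sqr_ge0// sqrrD !real_normK ?num_real//.
by rewrite addrAC lerDl mulrn_wge0// mulr_ge0.
Qed.

End modulus.

(** * The filter at infinity as the cofinite filter *)

Section cofinite.
Context {R : realType} {T : metricType R} (o : T).
Hypothesis T_locally_finite : locally_finite o.

Lemma at_inftyE (S : set T) : at_infty o S <-> finite_set (~` S).
Proof.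
split=> [[M _ MS]|finS].
  apply: (@sub_finite_set _ _ [set v | vlength o v < Num.max M 1]).
    move=> v nSv /=; rewrite lt_max ltNge; apply/orP; left.
    by apply/negP => /MS.
  by apply: T_locally_finite; rewrite lt_max ltr01 orbT.
have : finite_set (vlength o @` (~` S)) by exact: finite_image.
move=> /finite_seqP[s ss].
(* This sum exceeds every length attained on the finite complement. *)
exists (\sum_(x <- s) `|x| + 1) => // v /= vle; apply: contrapT => nSv.
have vs : vlength o v \in s.
  have : (vlength o @` (~` S)) (vlength o v) by exists v.
  by rewrite ss.
move: vle; rewrite (big_rem _ vs)/= leNgt => /negP; apply.
by rewrite ltr_pwDr// ler_wpDr ?ler_norm// sumr_ge0.
Qed.

Lemma cvg0_at_inftyP (h : T -> R) : (forall v, 0 <= h v) ->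
  h v @[v --> at_infty o] --> (0 : R) <->
  forall e, 0 < e -> finite_set [set v | e < h v].
Proof.
move=> h0; split=> [/cvgrPdist_le h_cvg e e0|fin].
  have /at_inftyE := h_cvg e e0; apply: sub_finite_set => v /= elt /=.
  by rewrite sub0r normrN ger0_norm// leNgt elt.
apply/cvgrPdist_le => e e0; apply/at_inftyE; apply: sub_finite_set (fin e e0).
by move=> v /=; rewrite sub0r normrN ger0_norm// => /negP; rewrite -ltNge.
Qed.

End cofinite.

(** * Norm, unit ball and neighbourhoods in [Lzero] *)

Section Lzero_theory.
Context {R : realType} {T : metricType R} {o : T} {mu : T -> {posnum R}}.
Hypothesis T_locally_finite : locally_finite o.
Local Notation X := (LzeroType o mu).
Implicit Types (f g : X) (s : seq T).

Lemma wmodN (h : T -> R[i]) v : wmod mu (- h) v = wmod mu h v.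
Proof. by rewrite -scaleN1r wmodZ normcN Normc.normc1 mul1r. Qed.

Lemma wmod_le_norm f v : wmod mu f v <= wnorm mu f.
Proof. by apply: wmod_le_wnorm; have /LzeroP[] := valP f. Qed.

Lemma Lzero_cvg f : wmod mu f v @[v --> at_infty o] --> (0 : R).
Proof. by have /LzeroP[] := valP f. Qed.

Lemma wnorm_ge0 f : 0 <= wnorm mu f.
Proof. exact: le_trans (wmod_ge0 mu f o) (wmod_le_norm f o). Qed.

Lemma Lzero_wnormD f g : wnorm mu (f + g : X) <= wnorm mu f + wnorm mu g.
Proof. by rewrite -lecR rmorphD -!Lzero_normE ler_normD. Qed.

Lemma Lzero_wnormB f g : wnorm mu (f - g : X) = wnorm mu (g - f : X).
Proof.
by apply: (@complexI R); rewrite -!Lzero_normE distrC.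
Qed.

Lemma Lzero_wnormMn f n : wnorm mu (f *+ n : X) = wnorm mu f *+ n.
Proof.
by apply: (@complexI R); rewrite -!Lzero_normE normrMn rmorphMn.
Qed.

Lemma unit_cballP f : unit_cball f <-> forall v, wmod mu f v <= 1.
Proof.
rewrite /unit_cball /= Lzero_normE -[1 in leRHS]/(1%:C)%C lecR; split.
  by move=> f1 v; exact: le_trans (wmod_le_norm f v) f1.
exact: wnorm_le.
Qed.

Lemma nbhs_Lzero (A : set X) f : nbhs f A <->
  exists2 e : R, 0 < e & forall g, wnorm mu (f - g : X) < e -> A g.
Proof.
rewrite -nbhs_nbhs_norm; split=> [[[a b] /= e0 sub]|[e e0 sub]].
  move: e0; rewrite ltcE /= => /andP[/eqP b0 a0]; exists a => // g fg.
  by apply: sub; rewrite /= b0 ltcR.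
exists (e%:C)%C; first by rewrite /= ltcR.
by move=> g /=; rewrite Lzero_normE ltcR; exact: sub.
Qed.

(** * Compactness in [Lzero] *)

(** Otherwise elements of norm above [n], one for each [n], would cluster at some [p], yet those of
    large index stay at distance at least 1 from [p]. *)
Lemma compact_wnorm_bounded (A : set X) :
  compact A -> exists M : R, forall f, A f -> wnorm mu f <= M.
Proof.
move=> cA; apply: contrapT => nM.
have /choice[x xP] (n : nat) : exists f, A f /\ n%:R < wnorm mu f.
  apply: contrapT => nf; apply: nM; exists n%:R => f Af.
  by rewrite leNgt; apply/negP => lt; apply: nf; exists f.
have [p [_ clp]] : A `&` cluster (x @ \oo) !=set0.
  by apply: cA; exists 0 => // n _; exact: (xP n).1.
pose n := Num.truncn (wnorm mu p + 1).
have [_ [[m /= nm <-] pm]] : [set x m | m in [set m | (n < m)%N]] `&`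
    [set g | wnorm mu (p - g : X) < 1] !=set0.
  apply: clp; last by apply/nbhs_Lzero; exists 1.
  by exists n.+1 => // m /= nm; exists m.
have : wnorm mu (x m) < wnorm mu p + 1.
  apply: le_lt_trans (_ : wnorm mu (p + (x m - p) : X) < _).
    by rewrite addrC subrK.
  apply: le_lt_trans (Lzero_wnormD _ _) _.
  by rewrite ltrD2l Lzero_wnormB.
apply/negP; rewrite -leNgt; apply: le_trans (ltW (xP m).2).
apply: le_trans (ltW (truncnS_gt _)) _.
by rewrite ler_nat.
Qed.

(* Pointwise limits along an ultrafilter exist by compactness of the discs, and
   the domination makes the convergence uniform off a finite set. *)
Lemma dominated_compact (b : T -> R) :
  b v @[v --> at_infty o] --> (0 : R) ->
  compact [set f : X | forall v, wmod mu f v <= b v].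
Proof.
move=> b_cvg; rewrite compact_ultra => F UF FQ.
(* [P] is the real or imaginary part; domination confines [P (f v)] to the segment from [- r] to
   [r]. *)
have cvg_part (P : R[i] -> R) : (forall z, `|P z| <= Normc.normc z) ->
    forall v, exists x : R, (fun f : X => P (f v)) @ F --> x.
  move=> PN v; pose r := b v / (mu v)%:num.
  apply: (ultra_cvg_compact UF (@segment_compact R (- r) r)).
  apply: filterS FQ => f /(_ v) fb /=.
  rewrite in_itv /= -ler_norml (le_trans (PN _))//.
  by rewrite /r ler_pdivlMr// mulrC.
have /choice[re reP] := cvg_part _ Re_le_normc.
have /choice[im imP] := cvg_part _ Im_le_normc.
pose g v := (re v +i* im v)%C.
pose D (f : X) v := wmod mu ((f : T -> R[i]) - g) v.
have g_cvg v e : 0 < e -> \forall f \near F, D f v < e.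
  move=> e0; have d0 : 0 < e / (mu v)%:num / 2 by rewrite !divr_gt0.
  have /cvgrPdist_lt/(_ _ d0) reF := reP v.
  have /cvgrPdist_lt/(_ _ d0) imF := imP v.
  near=> f; rewrite /D /wmod mulrC -ltr_pdivlMr//.
  apply: le_lt_trans (normc_le_Re_Im _) _; rewrite [ltRHS]splitr.
  rewrite -[((f : T -> R[i]) - g) v]/(f v - g v) !raddfB /=.
  apply: ltrD; rewrite distrC.
    by near: f; exact: reF.
  by near: f; exact: imF.
have gb v : wmod mu g v <= b v.
  apply/ler_addgt0Pr => e e0.
  have [f [fe fb]] := filter_ex (filterI (g_cvg v e e0) FQ).
  rewrite (_ : g = (f : T -> R[i]) - ((f : T -> R[i]) - g)); last first.
    by rewrite opprB addrC subrK.
  by apply: le_trans (wmodD _ _ _ _) (lerD (fb v) _); rewrite wmodN ltW.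
have b0 v : 0 <= b v by exact: le_trans (wmod_ge0 mu g v) (gb v).
have bfin := (cvg0_at_inftyP T_locally_finite b0).1 b_cvg.
have gL : g \in Lzero o mu.
  apply/LzeroP; split; last first.
    apply/(cvg0_at_inftyP T_locally_finite (wmod_ge0 mu g)) => e /bfin.
    by apply: sub_finite_set => v /= /lt_le_trans; apply.
  have /filter_ex[f fb] := FQ.
  have /finite_seqP[s ss] := finite_image (wmod mu g) (bfin 1 ltr01).
  (* [b <= 1] off a finite set, and the sum bounds [wmod mu g] on that set. *)
  exists (1 + \sum_(x <- s) `|x|) => _ [v _ <-].
  have [b1|b1] := leP (b v) 1.
    by rewrite ler_wpDr ?(le_trans (gb v))// sumr_ge0.
  have vs : wmod mu g v \in s.
    have : (wmod mu g @` [set v | 1 < b v]) (wmod mu g v) by exists v.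
    by rewrite ss.
  by rewrite (big_rem _ vs)/= addrCA ler_wpDr ?ler_norm// addr_ge0 ?sumr_ge0.
exists (MkLzero gL); split => // A /nbhs_Lzero[e e0 eA].
(* Where [b <= e / 4], both [f] and the limit are at most [e / 4], so they differ by at most
   [e / 2]; on the finite rest, listed by [s], pointwise convergence is used. *)
have e40 : 0 < e / 4 by rewrite divr_gt0.
have /finite_seqP[s ss] := bfin _ e40.
have Fs : \forall f \near F, forall v, v \in s -> D f v < e / 2.
  elim: s {ss} => [|u s IH]; first by apply: nearW.
  near=> f; move=> v; rewrite inE => /orP[/eqP ->|vs].
    by near: f; apply: g_cvg; rewrite divr_gt0.
  by move: v vs; near: f.
near=> f; apply: eA; rewrite Lzero_wnormB.
apply: (@le_lt_trans _ _ (e / 2)).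
  2: by rewrite ltr_pdivrMr// ltr_pMr// ltr1n.
apply: (wnorm_le o) => v; have [bv|bv] := leP (b v) (e / 4); last first.
  have vs : v \in s by have : [set v | e / 4 < b v] v by []; rewrite ss.
  by apply: ltW; move: v vs {bv}; near: f.
apply: le_trans (wmodD _ _ _ _) _; rewrite wmodN.
rewrite (_ : e / 2 = e / 4 + e / 4); last by field.
apply: lerD; last exact: le_trans (gb v) bv.
apply: le_trans bv; move: v.
by near: f.
Unshelve. all: by end_near. Qed.

Lemma compact_op_dominated (A : {linear X -> X}) (b : T -> R) :
  b v @[v --> at_infty o] --> (0 : R) ->
  (forall f, (forall v, wmod mu f v <= 1) ->
    forall v, wmod mu (A f) v <= b v) ->
  compact_op A.
Proof.
move=> /dominated_compact cb Ab.
exists [set f : X | forall v, wmod mu f v <= b v].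
  by move=> _ [f /unit_cballP f1 <-]; exact: Ab.
by split => //; exact: compact_closed cb.
Qed.

(** * Normalized point masses and their finite sums *)

(** Dividing by the weight makes the weighted modulus the indicator of [s], so the unit ball
    contains these functions however long [s] is. *)
Definition peak_fun s (v : T) : R[i] :=
  if v \in s then (((mu v)%:num)^-1)%:C%C else 0.

Lemma wmod_peak_fun s v : wmod mu (peak_fun s) v = (v \in s)%:R.
Proof.
rewrite /wmod /peak_fun; case: ifP => _; last by rewrite Normc.normc0 mulr0.
by rewrite normc_real ?divff ?invr_ge0.
Qed.

Lemma peak_fun_Lzero s : peak_fun s \in Lzero o mu.
Proof.
apply/LzeroP; split.
  by exists 1 => _ [v _ <-]; rewrite wmod_peak_fun; case: (_ \in _).
apply/(cvg0_at_inftyP T_locally_finite (wmod_ge0 _ _)) => e e0.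
apply: sub_finite_set (finite_seq s) => v /=; rewrite wmod_peak_fun.
by case: (v \in s) => //=; rewrite ltNge ltW.
Qed.

Definition peak s : X := MkLzero (peak_fun_Lzero s).

Lemma unit_cball_peak s : unit_cball (peak s).
Proof. by apply/unit_cballP => v; rewrite wmod_peak_fun; case: (_ \in _). Qed.

Lemma peak_nil : peak [::] = 0.
Proof. exact: val_inj. Qed.

Lemma peak_cons u s : u \notin s -> peak (u :: s) = peak [:: u] + peak s.
Proof.
move=> us; apply: val_inj; apply/funext => v.
change (peak_fun (u :: s) v = peak_fun [:: u] v + peak_fun s v).
rewrite /peak_fun !inE; have [->|vu] := eqVneq v u; last by rewrite add0r.
by rewrite (negbTE us) addr0.
Qed.

(* Otherwise the images of infinitely many peaks cluster at some [g != 0];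
   sums of [n] disjoint peaks stay in the unit ball while their images are
   close to [n g], contradicting boundedness. *)
Lemma compact_op_peak_finite (K : {linear X -> X}) (e : R) :
  compact_op K -> 0 < e -> finite_set [set u | e < wnorm mu (K (peak [:: u]))].
Proof.
move=> [B KB [cB _]] e0; apply: contrapT => infU.
set U := [set u | _] in infU.
(* Sets containing all but finitely many points of [U]; this filter is proper because [U] is
   infinite. *)
pose F : set_system T := [set S | finite_set (U `\` S)].
have FF : ProperFilter F.
  split; first by rewrite /F /= setD0.
  split; first by rewrite /F /= setDT.
    by move=> P Q FP FQ; rewrite /F /= setDIr finite_setU.
  by move=> P Q PQ; apply: sub_finite_set; exact: setDS.
have FU : F U by rewrite /F /= setDv.
have [g [_ clg]] : B `&` cluster (K (peak [:: u]) @[u --> F]) !=set0.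
  apply: cB; apply: (@filterE _ F) => u; apply: KB.
  by exists (peak [:: u]) => //; exact: unit_cball_peak.
have pick (d : R) (S : set T) : 0 < d -> F S -> exists u,
    S u /\ wnorm mu (K (peak [:: u]) - g : X) < d.
  move=> d0 FS.
  have [_ [[u Su <-] gd]] : [set K (peak [:: u]) | u in S] `&`
      [set h | wnorm mu (g - h : X) < d] !=set0.
    apply: clg; last by apply/nbhs_Lzero; exists d.
    by apply: (@filterS _ F _ _ _ _ FS) => u Su; exists u.
  by exists u; split => //; rewrite Lzero_wnormB.
(* Some image of norm above [e] lies within [e] of [g]. *)
have g0 : 0 < wnorm mu g.
  have [u [Uu Ku]] := pick e U e0 FU.
  have := Lzero_wnormD g (K (peak [:: u]) - g); rewrite addrC subrK => le.
  move: Uu; rewrite /U /= => Uu; lra.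
have [M BM] := compact_wnorm_bounded cB.
have sums n : exists2 s, size s = n &
    wnorm mu (K (peak s) - g *+ n : X) <= (wnorm mu g / 2) *+ n.
  elim: n => [|n [s sn IH]].
    exists [::] => //; rewrite peak_nil linear0 mulr0n subr0 mulr0n.
    by apply: (wnorm_le o) => v; rewrite wmod0.
  (* A point outside [s] is available since the complement of a finite list belongs to [F]. *)
  have [u [us Ku]] : exists u, (~` [set` s]) u /\
      wnorm mu (K (peak [:: u]) - g : X) < wnorm mu g / 2.
    apply: pick; first by rewrite divr_gt0.
    by rewrite /F /= setDE setCK; apply: finite_setIr; exact: finite_seq.
  exists (u :: s); first by rewrite /= sn.
  rewrite peak_cons; last exact/negP.
  rewrite linearD mulrS opprD addrACA mulrS.
  exact: le_trans (Lzero_wnormD _ _) (lerD (ltW Ku) IH).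
(* This makes [n] times half the norm of [g] exceed [M], whereas [sums] bounds it by the norm of
   [K (peak s)]. *)
pose n := (Num.truncn (M / (wnorm mu g / 2))).+1.
have [s _ sb] := sums n.
have KM : wnorm mu (K (peak s)) <= M.
  by apply: BM; apply: KB; exists (peak s) => //; exact: unit_cball_peak.
have := Lzero_wnormD (K (peak s)) (g *+ n - K (peak s)).
rewrite addrC subrK Lzero_wnormMn Lzero_wnormB => le.
have : M < (wnorm mu g / 2) *+ n.
  rewrite -mulr_natl -ltr_pdivrMr ?divr_gt0//; exact: truncnS_gt.
move=> Mn; move: le; rewrite [wnorm mu g]splitr mulrnDl; move: sb KM Mn.
move: (wnorm mu (K (peak s))) (wnorm mu (_ - _)) (_ / 2 *+ n) => x y z; lra.
Qed.

(** * Truncation to a set *)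

Definition truncate_fun (F : set T) (f : T -> R[i]) (v : T) : R[i] :=
  if v \in F then f v else 0.

Lemma wmod_truncate_fun F f v :
  wmod mu (truncate_fun F f) v = if v \in F then wmod mu f v else 0.
Proof.
by rewrite /wmod /truncate_fun; case: ifP => // _; rewrite Normc.normc0 mulr0.
Qed.

Lemma truncate_fun_Lzero F f : truncate_fun F f \in Lzero o mu.
Proof.
have le v : wmod mu (truncate_fun F f) v <= wmod mu f v.
  by rewrite wmod_truncate_fun; case: ifP => // _; exact: wmod_ge0.
apply/LzeroP; split.
  by exists (wnorm mu f) => _ [v _ <-]; exact: le_trans (wmod_le_norm f v).
apply/(cvg0_at_inftyP T_locally_finite (wmod_ge0 _ _)) => e e0.
have /(cvg0_at_inftyP T_locally_finite (wmod_ge0 _ _))/(_ e e0) := @Lzero_cvg f.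
by apply: sub_finite_set => v /= /lt_le_trans; apply.
Qed.

Definition truncate F f : X := MkLzero (truncate_fun_Lzero F f).

Lemma truncate_is_linear F : linear (truncate F).
Proof.
move=> a f g; apply: val_inj; apply/funext => v.
change (truncate_fun F (a *: f + g : X) v
  = a *: truncate_fun F f v + truncate_fun F g v).
by rewrite /truncate_fun; case: ifP => // _; rewrite scaler0 addr0.
Qed.

HB.instance Definition _ F :=
  GRing.isLinear.Build _ _ _ _ (truncate F) (truncate_is_linear F).

(** * Weighted composition operators *)

Section weighted_composition.
Variables (psi : T -> R[i]) (phi : T -> T).

Definition comp_weight (v : T) : R :=
  (mu v)%:num / (mu (phi v))%:num * Normc.normc (psi v).
Local Notation w := comp_weight.

Lemma comp_weight_ge0 v : 0 <= w v.
Proof. by rewrite mulr_ge0 ?divr_ge0 ?normc_ge0. Qed.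

Lemma wmod_wcomp (f : T -> R[i]) v :
  wmod mu (wcomp psi phi f) v = w v * wmod mu f (phi v).
Proof. by rewrite /wmod /wcomp /w Normc.normcM; field. Qed.

Variable W : {linear X -> X}.
Hypothesis W_def : forall f, (W f : T -> R[i]) = wcomp psi phi f.

Lemma wmod_W f v : wmod mu (W f) v = w v * wmod mu f (phi v).
Proof. by rewrite W_def wmod_wcomp. Qed.

(** If [s] lists [F], then [W (peak s)] decays at infinity, and its weighted modulus is [w v]
    wherever [phi v] is in [F]. *)
Lemma comp_weight_fiber (F : set T) (e : R) : finite_set F -> 0 < e ->
  finite_set [set v | F (phi v) /\ e < w v].
Proof.
move=> /finite_seqP[s ->] e0.
have /(cvg0_at_inftyP T_locally_finite (wmod_ge0 _ _))/(_ e e0) :=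
  @Lzero_cvg (W (peak s)).
apply: sub_finite_set => v /= [vs ev].
by rewrite wmod_W wmod_peak_fun vs mulr1.
Qed.

(** With [p] the peak at [phi v], [w v] is at most [a] plus the norm of [K p]. So [a + e < w v] puts
    [phi v] in a finite set, whose fibres contain finitely many such [v]. *)
Lemma comp_weight_le_compact_perturbation (K : {linear X -> X}) (a e : R) :
  compact_op K -> 0 <= a -> 0 < e ->
  (forall f, unit_cball f -> wnorm mu (W f - K f : X) <= a) ->
  finite_set [set v | a + e < w v].
Proof.
move=> cK a0 e0 le_a.
apply: sub_finite_set (comp_weight_fiber (compact_op_peak_finite cK e0) e0).
move=> v /= aev; split; last by apply: le_lt_trans aev; rewrite lerDr.
rewrite ltNge; apply/negP => Ke; move: aev; apply/negP; rewrite -leNgt.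
set p := peak [:: phi v] in Ke *.
have := Lzero_wnormD (W p - K p) (K p); rewrite subrK => le.
have := wmod_le_norm (W p) v.
rewrite wmod_W wmod_peak_fun inE eqxx mulr1 => /le_trans; apply.
by apply: le_trans le _; apply: lerD => //; apply: le_a; exact: unit_cball_peak.
Qed.

(** The images of the unit ball are dominated by [w] cut off to the preimage of [F], which decays by
    [comp_weight_fiber]. *)
Lemma compact_W_truncate (F : set T) : finite_set F ->
  compact_op (W \o truncate F : {linear X -> X}).
Proof.
move=> finF; pose b v := if phi v \in F then w v else 0.
have b0 v : 0 <= b v by rewrite /b; case: ifP => // _; exact: comp_weight_ge0.
apply: (@compact_op_dominated _ b).
  apply/(cvg0_at_inftyP T_locally_finite b0) => e e0.
  apply: sub_finite_set (comp_weight_fiber finF e0) => v /=.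
  rewrite /b; case: ifPn => [/set_mem //|_]; by rewrite ltNge ltW.
move=> f f1 v; rewrite /= wmod_W wmod_truncate_fun /b.
by case: ifP; rewrite ?mulr0// ler_piMr ?comp_weight_ge0.
Qed.

End weighted_composition.
End Lzero_theory.

(** * Essential norm and compactness criterion *)

Theorem theorem4p6 (R : realType) (T : metricType R) (o : T)
  (T_locally_finite : locally_finite o) (T_unbounded : unbounded_from o)
  (mu : T -> {posnum R}) (mu_typical : typical_weight o mu)
  (psi : T -> R[i]) (phi : T -> T) (phi_range : infinite_set (range phi))
  (W : {linear LzeroType o mu -> LzeroType o mu})
  (W_def : forall f : LzeroType o mu,
     (W f : T -> R[i]) = wcomp psi phi (f : T -> R[i]))
  (W_bounded : bounded_op W) :
  let w (v : T) : R := (mu v)%:num / (mu (phi v))%:num * Normc.normc (psi v) in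
  essnorm W = limf_esup (fun v => (w v)%:E) (at_infty o) /\
  (compact_op W <-> w v @[v --> at_infty o] --> (0 : R)).
Proof.
move=> w; have w0 : forall v, 0 <= w v by exact: comp_weight_ge0.
have Re_norm (f : LzeroType o mu) : complex.Re `|f| = wnorm mu f by [].
have perturb := comp_weight_le_compact_perturbation T_locally_finite W_def.
split; last split.
- apply/eqP; rewrite eq_le; apply/andP; split.
  (* Upper bound: the limsup is an infimum over neighbourhoods [V] of infinity, so each [V] is
     treated separately. *)
  + apply: le_ereal_inf_tmp => _ [V infV <-].
    (* A point of [V] rules out the supremum [-oo] and gives [0 <= r]. *)
    have [v0 Vv0] : V !=set0.
      have max1 (M : R) : 0 < Num.max M 1 by rewrite lt_max ltr01 orbT.
      case: infV => M _ MV; have [v vM] := T_unbounded _ (max1 M).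
      by exists v; apply: MV; rewrite /= (le_trans _ vM)// le_max lexx.
    have finV : finite_set (phi @` (~` V)).
      by apply: finite_image; exact/(at_inftyE T_locally_finite).
    pose P := truncate T_locally_finite (phi @` (~` V)) :
      {linear LzeroType o mu -> LzeroType o mu}.
    apply: ereal_inf_le; exists (opnorm (W \- (W \o P))).
      by exists (W \o P : {linear _ -> _}) => //; exact: compact_W_truncate.
    apply: ge_ereal_sup => _ [f /unit_cballP f1 <-].
    rewrite Re_norm.
    have supV v : V v -> ((w v)%:E <= ereal_sup [set (w v)%:E | v in V])%E.
      by move=> Vv; apply: ereal_sup_ubound; exists v.
    case: (ereal_sup _) supV => [r| |] supV; last 2 first.
    * exact: leey.
    * by have := supV _ Vv0.
    have {}supV v : V v -> w v <= r by move=> /supV; rewrite lee_fin.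
    have r0 : 0 <= r := le_trans (w0 v0) (supV v0 Vv0).
    rewrite lee_fin; apply: (wnorm_le o) => v.
    rewrite [(_ \- _) f](_ : _ = W (f - P f)); last by rewrite linearB.
    rewrite (wmod_W W_def).
    (* [f - P f] vanishes on [phi (~V)], so only points of [V] contribute. *)
    have -> : wmod mu (f - P f : LzeroType o mu) (phi v) =
        if phi v \in phi @` (~` V) then 0 else wmod mu f (phi v).
      rewrite /wmod -[Lzero_fun _ _]/(f (phi v) -
        truncate_fun (phi @` (~` V)) f (phi v)).
      rewrite /truncate_fun; case: ifP => _; last by rewrite subr0.
      by rewrite subrr Normc.normc0 mulr0.
    case: ifPn => [_|vV]; first by rewrite mulr0.
    have Vv : V v.
      by apply: contrapT => nVv; move/negP: vV; apply; rewrite inE; exists v.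
    by apply: le_trans (supV v Vv); rewrite ler_piMr.
  (* Lower bound: for compact [K], [w] exceeds [opnorm (W \- K)] plus [e] at only finitely many
     points. *)
  + apply: le_ereal_inf_tmp => _ [K cK <-].
    have Kle f : unit_cball f ->
        ((wnorm mu (W f - K f : LzeroType o mu))%:E <= opnorm (W \- K)%R)%E.
      by move=> f1; apply: ereal_sup_ubound; exists f.
    case: (opnorm _) Kle => [a| |] Kle; last 2 first.
    * exact: leey.
    * by have := Kle _ (unit_cball_peak T_locally_finite [::]).
    have {}Kle f : unit_cball f -> wnorm mu (W f - K f : LzeroType o mu) <= a.
      by move=> /Kle; rewrite lee_fin.
    have a0 : 0 <= a.
      apply: le_trans (Kle _ (unit_cball_peak T_locally_finite [::])).
      exact: wnorm_ge0.
    apply/lee_addgt0Pr => e e0.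
    apply: ereal_inf_le.
    exists (ereal_sup [set (w v)%:E | v in [set v | w v <= a + e]]).
      exists [set v | w v <= a + e] => //.
      apply/(at_inftyE T_locally_finite).
      apply: sub_finite_set (perturb K a e cK a0 e0 Kle) => v /= /negP.
      by rewrite -ltNge.
    by apply: ge_ereal_sup => _ [v wv <-]; rewrite -EFinD lee_fin.
(* [perturb] is applied to [W] itself, at distance 0. *)
- move=> cW; apply/(cvg0_at_inftyP T_locally_finite w0) => e e0.
  rewrite -[e]add0r; apply: perturb cW _ e0 _ => // f _.
  by rewrite subrr; apply: (wnorm_le o) => v; rewrite wmod0.
(* On the unit ball, [w] itself dominates the images under [W]. *)
- move=> w_cvg; apply: (compact_op_dominated T_locally_finite w_cvg) => f f1 v.
  by rewrite (wmod_W W_def) ler_piMr.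
Qed.
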